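(* Let $d\ge 1$, let $q$ be an integer with $0\le q\le d-1$, and let $\mu=(\mu_0,\ldots,\mu_q)\in\mathbb{R}^{q+1}$ be arbitrary. Let $S_q(\mu)\subset\mathcal{P}_d$ be the Prony leaf, i.e. the set of all $(A,X)\in\mathcal{P}_d$ with $\sum_{j=1}^d a_jx_j^k=\mu_k$ for $k=0,1,\ldots,q$. Then: (1) $S_q(\mu)$ is a smooth subvariety of $\mathcal{P}_d$ of dimension $2d-q-1$. (2) The projection $\pi:S_q(\mu)\to\mathcal{P}^X_d$, $(A,X)\mapsto X$, is onto, and forms a regular locally trivial fibration over $\mathcal{P}^X_d$. The fibers of $\pi$ are affine subvarieties of dimension $d-q-1$ in $\mathcal{P}_d$. (3) The amplitudes $a_{q+2},\ldots,a_d$ and all the nodes $x_1<x_2<\ldots<x_d$ can be chosen as the coordinates on $S_q(\mu)$, while the amplitudes $a_1,\ldots,a_{q+1}$ are expressed in these coordinates as $$a_j=\sum_{l=0}^q A_{j,l}(X)\,\mu_l+\sum_{s=q+2}^d B_{j,s}(X)\,a_s,\qquad j=1,\ldots,q+1,$$ where $A_{j,l}(X)$ and $B_{j,s}(X)$ are rational functions of $X=(x_1,\ldots,x_d)$ that are regular on $\mathcal{P}^X_d$.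
   Context: Parameter space: $\mathcal{P}^A_d=\mathbb{R}^d$ is the space of amplitudes $A=(a_1,\ldots,a_d)$; $\mathcal{P}^X_d=\{X=(x_1,\ldots,x_d)\in\mathbb{R}^d : x_1<x_2<\cdots<x_d\}$ is the space of nodes (nodes are always assumed pairwise different and ordered); $\mathcal{P}_d=\mathcal{P}^A_d\times\mathcal{P}^X_d$. The map $\pi:\mathcal{P}_d\to\mathcal{P}^X_d$ is the projection $(A,X)\mapsto X$. A rational function is regular on $\mathcal{P}^X_d$ if it can be written with a denominator that does not vanish at any point of $\mathcal{P}^X_d$. When $q=d-1$ the list $a_{q+2},\ldots,a_d$ and the second sum are empty. *)

(* Defs.v *)
From HB Require Import structures.
From mathcomp Require Import all_boot all_order all_algebra.
From mathcomp Require Import all_classical all_reals all_analysis.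
(* The notations of mpoly and of MathComp-Analysis cannot be loaded together. *)
From mathcomp Require Import -(notations) mpoly.

Set Implicit Arguments.
Unset Strict Implicit.
Unset Printing Implicit Defensive.

Import Order.TTheory GRing.Theory Num.Theory numFieldNormedType.Exports.
Local Open Scope classical_set_scope.
Local Open Scope ring_scope.

Definition peval (R : realType) (n : nat) (p : mpoly n R) (x : 'rV[R]_n) : R :=
  meval (x 0) p.

Definition regular_on (R : realType) (n : nat) (V : set 'rV[R]_n)
    (f : 'rV[R]_n -> R) : Prop :=
  exists p q : mpoly n R,
    forall x, V x -> peval q x != 0 /\ f x = peval p x / peval q x.

Definition regular_map (R : realType) (n m : nat) (V : set 'rV[R]_n)
    (f : 'rV[R]_n -> 'rV[R]_m) : Prop :=
  forall j : 'I_m, regular_on V (fun x => f x 0 j).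

Definition biregular (R : realType) (n m : nat) (V : set 'rV[R]_n)
    (W : set 'rV[R]_m) (f : 'rV[R]_n -> 'rV[R]_m) : Prop :=
  exists g : 'rV[R]_m -> 'rV[R]_n,
    [/\ regular_map V f, regular_map W g,
        forall x, V x -> W (f x) /\ g (f x) = x &
        forall y, W y -> V (g y) /\ f (g y) = y].

Definition zero_locus (R : realType) (n k : nat) (f : 'I_k -> mpoly n R) :
    set 'rV[R]_n :=
  [set x | forall i, peval (f i) x = 0].

Definition subvariety (R : realType) (n : nat) (P V : set 'rV[R]_n) : Prop :=
  exists k (f : 'I_k -> mpoly n R), V = P `&` zero_locus f.

Definition jacobian (R : realType) (n k : nat) (f : 'I_k -> mpoly n R)
    (x : 'rV[R]_n) : 'M[R]_(k, n) :=
  \matrix_(i, j) peval (mderiv j (f i)) x.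

(* Every point x of V is nonsingular in dimension m, in the sense of real
   algebraic geometry: near x (in the Euclidean topology), V is cut out by
   n - m polynomials of its ideal whose differentials at x are linearly
   independent. Irreducibility is not part of the notion of subvariety. *)
Definition smooth_subvariety (R : realType) (n : nat) (P V : set 'rV[R]_n)
    (m : nat) : Prop :=
  subvariety P V /\
  forall x, V x ->
    exists k (f : 'I_k -> mpoly n R) (U : set 'rV[R]_n),
      [/\ (k + m = n)%N, V `<=` zero_locus f, open U /\ U x,
          V `&` U = P `&` U `&` zero_locus f & \rank (jacobian f x) = k].

Definition affine_subspace (R : realType) (n : nat) (V : set 'rV[R]_n)
    (m : nat) : Prop :=
  exists (v : 'rV[R]_n) (W : {vspace 'rV[R]_n}),
    \dim W = m /\ V = [set x | x - v \in W].

(* The product of subsets of R^m and R^k, as a subset of R^(m+k). *)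
Definition row_prod (R : realType) (m k : nat) (V : set 'rV[R]_m)
    (W : set 'rV[R]_k) : set 'rV[R]_(m + k) :=
  [set z | V (lsubmx z) /\ W (rsubmx z)].

(* Local triviality is with respect to the Euclidean topology of the base; the
   local trivializations are biregular and commute with the projections. *)
Definition regular_locally_trivial_fibration (R : realType) (n m : nat)
    (E : set 'rV[R]_n) (B : set 'rV[R]_m) (pi : 'rV[R]_n -> 'rV[R]_m) : Prop :=
  [/\ regular_map E pi, forall e, E e -> B (pi e) &
      exists k (F : set 'rV[R]_k), forall b, B b ->
        exists (U : set 'rV[R]_m) (h : 'rV[R]_n -> 'rV[R]_(m + k)),
          [/\ open U, U b,
              biregular (E `&` pi @^-1` U) (row_prod (B `&` U) F) h &
              forall e, E e -> U (pi e) -> lsubmx (h e) = pi e]].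

Definition global_coordinates (R : realType) (n m : nat) (V : set 'rV[R]_n)
    (W : set 'rV[R]_m) (phi : 'rV[R]_n -> 'rV[R]_m) : Prop :=
  open W /\ biregular V W phi.

(* A point (A, X) of R^d x R^d is encoded as the row vector row_mx A X. *)
Definition amplitudes (R : realType) (d : nat) (p : 'rV[R]_(d + d)) : 'rV[R]_d :=
  lsubmx p.

Definition nodes (R : realType) (d : nat) (p : 'rV[R]_(d + d)) : 'rV[R]_d :=
  rsubmx p.

Definition node_space (R : realType) (d : nat) : set 'rV[R]_d :=
  [set X | forall i j : 'I_d, (i < j)%N -> X 0 i < X 0 j].

Definition param_space (R : realType) (d : nat) : set 'rV[R]_(d + d) :=
  [set p | node_space (nodes p)].

Definition prony_leaf (R : realType) (d q : nat) (mu : 'rV[R]_q.+1) :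
    set 'rV[R]_(d + d) :=
  [set p | param_space p /\
     forall k : 'I_q.+1,
       \sum_(j < d) amplitudes p 0 j * nodes p 0 j ^+ k = mu 0 k].

(* Indices are 0-based: the i-th of the last d - q - 1 indices of 'I_d is
   q + 1 + i. *)
Definition tail_index (d q : nat) (hq : (q < d)%N) (i : 'I_(d - q.+1)) : 'I_d :=
  cast_ord (subnKC hq) (rshift q.+1 i).

Definition leaf_coordinates (R : realType) (d q : nat) (hq : (q < d)%N)
    (p : 'rV[R]_(d + d)) : 'rV[R]_(d - q.+1 + d) :=
  row_mx (\row_i amplitudes p 0 (tail_index hq i)) (nodes p).

Arguments node_space : clear implicits.
Arguments param_space : clear implicits.
Arguments prony_leaf {R} d {q} mu.

(* Main.v *)
(* For fixed nodes the Prony equations are linear in the amplitudes, and the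
   columns of the first q + 1 amplitudes form a square Vandermonde matrix H(X),
   which is invertible since the nodes are pairwise different.  Writing T(X)
   for the columns of the remaining amplitudes t, the first amplitudes h are
   h = (mu - t T(X)) H(X)^-1 (in row-vector form), whose coefficients are
   regular by Cramer's rule.  Hence the leaf is the graph of a regular map over
   the free coordinates (t, X), which gives global coordinates and a global
   trivialization of the projection to the nodes; the fibers are affine since
   h is affine in t.  The leaf is smooth because the amplitude part of the
   Jacobian of the Prony equations contains H(X). *)

Require Import Defs.
From HB Require Import structures.
From mathcomp Require Import all_boot all_order all_algebra.
From mathcomp Require Import all_classical all_reals all_analysis.
From mathcomp Require Import -(notations) mpoly.

Set Implicit Arguments.
Unset Strict Implicit.
Unset Printing Implicit Defensive.

Import Order.TTheory GRing.Theory Num.Theory numFieldNormedType.Exports.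
Local Open Scope classical_set_scope.
Local Open Scope ring_scope.

(** * Closure properties of regular functions *)

Section RegularFunctions.
Variables (R : realType) (n : nat) (V : set 'rV[R]_n).
Implicit Types f g : 'rV[R]_n -> R.

Lemma eq_regular_on f g :
  (forall x, V x -> f x = g x) -> regular_on V f -> regular_on V g.
Proof.
move=> fg [p [q pq]]; exists p, q => x Vx; have [q0 fE] := pq x Vx.
by rewrite -fg.
Qed.

Lemma regular_on_cst c : regular_on V (fun=> c).
Proof.
exists (mpolyC n c), (mpolyC n 1) => x _.
by rewrite /peval !mevalC oner_neq0 divr1.
Qed.

Lemma regular_on_coord i : regular_on V (fun x => x 0 i).
Proof.
exists (mpolyX R (mnm1 i)), (mpolyC n 1) => x _.
by rewrite /peval mevalC mevalXU oner_neq0 divr1.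
Qed.

Lemma regular_onD f g :
  regular_on V f -> regular_on V g -> regular_on V (fun x => f x + g x).
Proof.
move=> [p [q pq]] [p' [q' pq']].
exists (p * q' + p' * q), (q * q') => x Vx.
have [q0 ->] := pq x Vx; have [q'0 ->] := pq' x Vx.
rewrite /peval rmorphD !rmorphM /= mulf_neq0 //; split => //.
by rewrite addf_div.
Qed.

Lemma regular_onM f g :
  regular_on V f -> regular_on V g -> regular_on V (fun x => f x * g x).
Proof.
move=> [p [q pq]] [p' [q' pq']].
exists (p * p'), (q * q') => x Vx.
have [q0 ->] := pq x Vx; have [q'0 ->] := pq' x Vx.
rewrite /peval !rmorphM /= mulf_neq0 //; split => //.
by rewrite mulf_div.
Qed.

Lemma regular_onN f : regular_on V f -> regular_on V (fun x => - f x).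
Proof.
move=> rf; apply: (@eq_regular_on (fun x => -1 * f x)).
  by move=> x _; rewrite mulN1r.
exact: regular_onM (regular_on_cst _) rf.
Qed.

Lemma regular_onB f g :
  regular_on V f -> regular_on V g -> regular_on V (fun x => f x - g x).
Proof. by move=> rf /regular_onN; exact: regular_onD. Qed.

(** Numerator and denominator are exchanged: where the value of [f] is nonzero, so is its
    numerator. *)
Lemma regular_onV f :
  (forall x, V x -> f x != 0) -> regular_on V f ->
  regular_on V (fun x => (f x)^-1).
Proof.
move=> f0 [p [q pq]]; exists q, p => x Vx.
have := f0 x Vx; have [q0 ->] := pq x Vx.
by rewrite mulf_eq0 invr_eq0 negb_or invf_div => /andP[].
Qed.

Lemma regular_onX f k : regular_on V f -> regular_on V (fun x => f x ^+ k).
Proof.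
move=> rf; elim: k => [|k IHk]; first exact: regular_on_cst.
apply: (@eq_regular_on (fun x => f x * f x ^+ k)).
  by move=> x _; rewrite exprS.
exact: regular_onM.
Qed.

Lemma regular_on_sum (I : Type) (r : seq I) (P : pred I)
    (F : I -> 'rV[R]_n -> R) :
  (forall i, P i -> regular_on V (F i)) ->
  regular_on V (fun x => \sum_(i <- r | P i) F i x).
Proof.
move=> rF; elim: r => [|i r IHr].
  apply: (@eq_regular_on (fun=> 0)); last exact: regular_on_cst.
  by move=> x _; rewrite big_nil.
have [Pi|nPi] := boolP (P i).
  apply: (@eq_regular_on _ _ _ (regular_onD (rF i Pi) IHr)) => x _.
  by rewrite big_cons Pi.
by apply: (@eq_regular_on _ _ _ IHr) => x _; rewrite big_cons (negbTE nPi).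
Qed.

Lemma regular_on_prod (I : Type) (r : seq I) (P : pred I)
    (F : I -> 'rV[R]_n -> R) :
  (forall i, P i -> regular_on V (F i)) ->
  regular_on V (fun x => \prod_(i <- r | P i) F i x).
Proof.
move=> rF; elim: r => [|i r IHr].
  apply: (@eq_regular_on (fun=> 1)); last exact: regular_on_cst.
  by move=> x _; rewrite big_nil.
have [Pi|nPi] := boolP (P i).
  apply: (@eq_regular_on _ _ _ (regular_onM (rF i Pi) IHr)) => x _.
  by rewrite big_cons Pi.
by apply: (@eq_regular_on _ _ _ IHr) => x _; rewrite big_cons (negbTE nPi).
Qed.

(** By the Leibniz expansion, a determinant is a signed sum of products of entries. *)
Lemma regular_on_det k (M : 'rV[R]_n -> 'M[R]_k) :
  (forall i j, regular_on V (fun x => M x i j)) ->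
  regular_on V (fun x => \det (M x)).
Proof.
move=> rM; apply: regular_on_sum => s _; apply: regular_onM.
  exact: regular_on_cst.
by apply: regular_on_prod => i _.
Qed.

Lemma regular_on_mulmx a b c (M : 'rV[R]_n -> 'M[R]_(a, b))
    (N : 'rV[R]_n -> 'M[R]_(b, c)) :
  (forall i j, regular_on V (fun x => M x i j)) ->
  (forall i j, regular_on V (fun x => N x i j)) ->
  forall i j, regular_on V (fun x => (M x *m N x) i j).
Proof.
move=> rM rN i j.
apply: (@eq_regular_on (fun x => \sum_k M x i k * N x k j)).
  by move=> x _; rewrite mxE.
by apply: regular_on_sum => k _; exact: regular_onM.
Qed.

(** Each entry of the inverse is a cofactor divided by the determinant. Both are regular as
    determinants, up to sign, of regular entries, and invertibility on [V] keeps the denominator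
    nonzero. *)
Lemma regular_on_invmx k (M : 'rV[R]_n -> 'M[R]_k) :
  (forall x, V x -> M x \in unitmx) ->
  (forall i j, regular_on V (fun x => M x i j)) ->
  forall i j, regular_on V (fun x => invmx (M x) i j).
Proof.
move=> uM rM i j.
apply: (@eq_regular_on (fun x => (\det (M x))^-1 *
  ((-1) ^+ (j + i) * \det (row' j (col' i (M x)))))).
  by move=> x Vx; rewrite /invmx uM // !mxE.
apply: regular_onM.
  apply: regular_onV; last exact: regular_on_det.
  by move=> x /uM; rewrite unitmxE unitfE.
apply: regular_onM; first exact: regular_on_cst.
apply: regular_on_det => i' j'.
apply: eq_regular_on (rM (lift j i') (lift i j')) => x _.
by rewrite !mxE.
Qed.

(** Expanding into monomials shows that a polynomial in regular functions is regular. This applies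
    to numerator and denominator of [f], and the latter does not vanish because [h] maps [V] into
    [W]. *)
Lemma regular_on_comp m (W : set 'rV[R]_m) (h : 'rV[R]_n -> 'rV[R]_m)
    (f : 'rV[R]_m -> R) :
  regular_map V h -> (forall x, V x -> W (h x)) -> regular_on W f ->
  regular_on V (fun x => f (h x)).
Proof.
move=> rh hV [p [q pq]].
have rpoly (s : mpoly m R) : regular_on V (fun x => peval s (h x)).
  apply: (@eq_regular_on (fun x => \sum_(e <- msupp s)
    mcoeff e s * \prod_i h x 0 i ^+ e i)).
    by move=> x _; rewrite /peval mevalE.
  apply: regular_on_sum => e _; apply: regular_onM; first exact: regular_on_cst.
  by apply: regular_on_prod => i _; exact: regular_onX.
apply: (@eq_regular_on (fun x => peval p (h x) / peval q (h x))).
  by move=> x /hV /pq[].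
apply: regular_onM => //; apply: regular_onV => //.
by move=> x /hV /pq[].
Qed.

End RegularFunctions.

(** * Regular and biregular maps between subsets of coordinate spaces *)

Lemma biregular_comp (R : realType) (n m k : nat) (V : set 'rV[R]_n)
    (W : set 'rV[R]_m) (Z : set 'rV[R]_k) f g :
  biregular V W f -> biregular W Z g -> biregular V Z (g \o f).
Proof.
move=> [f' [rf rf' ff' f'f]] [g' [rg rg' gg' g'g]]; exists (f' \o g'); split.
- by move=> j; apply: regular_on_comp rf _ (rg j) => x /ff'[].
- by move=> j; apply: regular_on_comp rg' _ (rf' j) => x /g'g[].
- move=> x Vx /=; have [Wf ffx] := ff' x Vx.
  by have [Zg ->] := gg' _ Wf.
- move=> y Zy /=; have [Wg ggy] := g'g y Zy.
  by have [Vf ->] := f'f _ Wg.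
Qed.

Lemma regular_map_row_mx (R : realType) (n a b : nat) (V : set 'rV[R]_n)
    (f : 'rV[R]_n -> 'rV[R]_a) (g : 'rV[R]_n -> 'rV[R]_b) :
  regular_map V f -> regular_map V g ->
  regular_map V (fun x => row_mx (f x) (g x)).
Proof.
move=> rf rg j; case: (split_ordP j) => i ->.
  by apply: eq_regular_on (rf i) => x _; rewrite row_mxEl.
by apply: eq_regular_on (rg i) => x _; rewrite row_mxEr.
Qed.

Lemma regular_map_colsub (R : realType) (n m : nat) (V : set 'rV[R]_n)
    (s : 'I_m -> 'I_n) : regular_map V (fun x => colsub s x).
Proof.
move=> j; apply: eq_regular_on (regular_on_coord _ (s j)) => x _.
by rewrite mxE.
Qed.

Lemma lsubmxE_colsub (R : Type) m a b (z : 'M[R]_(m, a + b)) :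
  lsubmx z = colsub (lshift b) z.
Proof. by apply/matrixP => i j; rewrite !mxE. Qed.

Lemma rsubmxE_colsub (R : Type) m a b (z : 'M[R]_(m, a + b)) :
  rsubmx z = colsub (@rshift a b) z.
Proof. by apply/matrixP => i j; rewrite !mxE. Qed.

Lemma regular_map_lsubmx (R : realType) (a b : nat) (V : set 'rV[R]_(a + b)) :
  regular_map V lsubmx.
Proof.
move=> j; apply: eq_regular_on (regular_map_colsub _ (lshift b) j) => x _.
by rewrite lsubmxE_colsub.
Qed.

Lemma regular_map_rsubmx (R : realType) (a b : nat) (V : set 'rV[R]_(a + b)) :
  regular_map V rsubmx.
Proof.
move=> j; apply: eq_regular_on (regular_map_colsub _ (@rshift a b) j) => x _.
by rewrite rsubmxE_colsub.
Qed.

(** The leaf coordinates list the nodes last, whereas a local trivialization must list the base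
    point first; this swap reconciles the two orders. *)
Lemma biregular_row_prodC (R : realType) (a b : nat) (V : set 'rV[R]_a)
    (W : set 'rV[R]_b) :
  biregular (row_prod V W) (row_prod W V)
    (fun z => row_mx (rsubmx z) (lsubmx z)).
Proof.
exists (fun z => row_mx (rsubmx z) (lsubmx z)); split.
- apply: regular_map_row_mx; first exact: regular_map_rsubmx.
  exact: regular_map_lsubmx.
- apply: regular_map_row_mx; first exact: regular_map_rsubmx.
  exact: regular_map_lsubmx.
- by move=> z [Vz Wz]; rewrite /row_prod /= !row_mxKl !row_mxKr hsubmxK.
- by move=> z [Vz Wz]; rewrite /row_prod /= !row_mxKl !row_mxKr hsubmxK.
Qed.

(** Finitely many strict inequalities between continuous coordinates define an open set. The
    selection [s] allows the nodes to be a part of a longer row. *)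
Lemma open_increasing_coords (R : realType) (d n : nat) (s : 'I_d -> 'I_n) :
  open [set z : 'rV[R]_n |
    forall i j : 'I_d, (i < j)%N -> z 0 (s i) < z 0 (s j)].
Proof.
rewrite openE => z zs.
have FF : Filter (nbhs z) by exact: nbhs_filter.
(* Indexing the inequalities by pairs allows a single finite intersection of neighbourhoods. *)
pose P (p : 'I_d * 'I_d) (z' : 'rV[R]_n) :=
  (p.1 < p.2)%N -> z' 0 (s p.1) < z' 0 (s p.2).
suff zN p : nbhs z (P p).
  apply: (filterS _ (filter_forall FF zN)) => z' zs' i j.
  exact: (zs' (i, j)).
case: p => i j; rewrite /P /=.
have [ij|ji] := boolP (i < j)%N; last exact: filterE.
have zB : ((z' 0 (s i) - z' 0 (s j)) @[z' --> z] -->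
    z 0 (s i) - z 0 (s j))%classic.
  by apply: cvgB; exact: coord_continuous.
near=> z'; rewrite -subr_lt0; move=> _; near: z'.
by apply: (cvgr_lt _ zB); rewrite subr_lt0; exact: zs.
Unshelve. all: by end_near.
Qed.

(** * Splitting the indices into the first q + 1 and the remaining d - q - 1 *)

Section PronyLeaf.
Variables (R : realType) (d q : nat) (hq : (q < d)%N).
Implicit Types (mu : 'rV[R]_q.+1) (X : 'rV[R]_d) (t : 'rV[R]_(d - q.+1)).
Implicit Types (p : 'rV[R]_(d + d)) (z : 'rV[R]_(d - q.+1 + d)).

Definition head_index (i : 'I_q.+1) : 'I_d :=
  cast_ord (subnKC hq) (lshift (d - q.+1) i).
Local Notation head := head_index.
Local Notation tail := (tail_index hq).

Lemma head_tail_ind (P : 'I_d -> Prop) :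
  (forall i, P (head i)) -> (forall i, P (tail i)) -> forall j, P j.
Proof.
move=> Ph Pt j; rewrite -(cast_ordKV (subnKC hq) j).
case: (split_ordP (cast_ord (esym (subnKC hq)) j)) => i ->.
  exact: Ph.
exact: Pt.
Qed.

Lemma big_head_tail (F : 'I_d -> R) :
  \sum_(j < d) F j =
  \sum_(i < q.+1) F (head i) + \sum_(i < d - q.+1) F (tail i).
Proof.
rewrite (reindex (cast_ord (subnKC hq))) /=; first by rewrite big_split_ord.
apply: onW_bij; exists (cast_ord (esym (subnKC hq))) => j.
  exact: cast_ordK.
exact: cast_ordKV.
Qed.

Lemma big_tail (F : 'I_d -> R) :
  \sum_(j < d | (q < j)%N) F j = \sum_(i < d - q.+1) F (tail i).
Proof.
rewrite big_mkcond big_head_tail /= big1 ?add0r; last first.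
  by move=> i _; rewrite ltnNge -ltnS ltn_ord.
by apply: eq_bigr => i _; rewrite leq_addr.
Qed.

(** The cast is needed because [q.+1 + (d - q.+1)] equals [d] only propositionally. The number of
    rows is general so that amplitude vectors and the matrix of fiber directions are treated
    alike. *)
Definition join_mx m (h : 'M[R]_(m, q.+1)) (t : 'M[R]_(m, d - q.+1)) :
    'M[R]_(m, d) :=
  castmx (erefl m, subnKC hq) (row_mx h t).

Lemma join_mx_head m (h : 'M[R]_(m, q.+1)) (t : 'M[R]_(m, d - q.+1))
    (k : 'I_m) i :
  join_mx h t k (head i) = h k i.
Proof. by rewrite castmxE /= cast_ordK cast_ord_id row_mxEl. Qed.

Lemma join_mx_tail m (h : 'M[R]_(m, q.+1)) (t : 'M[R]_(m, d - q.+1))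
    (k : 'I_m) i :
  join_mx h t k (tail i) = t k i.
Proof. by rewrite castmxE /= cast_ordK cast_ord_id row_mxEr. Qed.

Lemma colsub_head_join m (h : 'M[R]_(m, q.+1)) (t : 'M[R]_(m, d - q.+1)) :
  colsub head (join_mx h t) = h.
Proof. by apply/matrixP => k i; rewrite mxE join_mx_head. Qed.

Lemma colsub_tail_join m (h : 'M[R]_(m, q.+1)) (t : 'M[R]_(m, d - q.+1)) :
  colsub tail (join_mx h t) = t.
Proof. by apply/matrixP => k i; rewrite mxE join_mx_tail. Qed.

Lemma join_colsub m (M : 'M[R]_(m, d)) :
  join_mx (colsub head M) (colsub tail M) = M.
Proof.
apply/matrixP => k; apply: head_tail_ind => i.
  by rewrite join_mx_head mxE.
by rewrite join_mx_tail mxE.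
Qed.

Lemma join_mxD m (h h' : 'M[R]_(m, q.+1)) (t t' : 'M[R]_(m, d - q.+1)) :
  join_mx h t + join_mx h' t' = join_mx (h + h') (t + t').
Proof.
apply/matrixP => k; apply: head_tail_ind => i.
  by rewrite mxE !join_mx_head mxE.
by rewrite mxE !join_mx_tail mxE.
Qed.

Lemma mul_mx_join m n (M : 'M[R]_(m, n)) (h : 'M[R]_(n, q.+1))
    (t : 'M[R]_(n, d - q.+1)) :
  M *m join_mx h t = join_mx (M *m h) (M *m t).
Proof.
apply/matrixP => k; apply: head_tail_ind => i.
  by rewrite join_mx_head !mxE; apply: eq_bigr => l _; rewrite join_mx_head.
by rewrite join_mx_tail !mxE; apply: eq_bigr => l _; rewrite join_mx_tail.
Qed.

(** * The Prony equations as a linear system in the amplitudes *)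

Definition head_vdm X : 'M[R]_q.+1 := (Vandermonde q.+1 (colsub head X))^T.

Definition tail_vdm X : 'M[R]_(d - q.+1, q.+1) :=
  (Vandermonde q.+1 (colsub tail X))^T.

(** The Vandermonde determinant is the product of the differences of the first q + 1 nodes; none
    vanishes since [head_index] preserves the order of indices and the nodes increase. *)
Lemma head_vdm_unit X : node_space R d X -> head_vdm X \in unitmx.
Proof.
move=> nX; rewrite unitmx_tr unitmxE unitfE det_Vandermonde.
apply/prodf_neq0 => i _; apply/prodf_neq0 => j ij.
by rewrite !mxE subr_eq0 gt_eqF // nX.
Qed.

Lemma prony_leafE mu p : prony_leaf d mu p <->
  node_space R d (nodes p) /\
  colsub head (amplitudes p) *m head_vdm (nodes p) +
    colsub tail (amplitudes p) *m tail_vdm (nodes p) = mu.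
Proof.
have momE k : (colsub head (amplitudes p) *m head_vdm (nodes p) +
    colsub tail (amplitudes p) *m tail_vdm (nodes p)) 0 k =
    \sum_(j < d) amplitudes p 0 j * nodes p 0 j ^+ k.
  rewrite big_head_tail !mxE.
  by congr (_ + _); apply: eq_bigr => i _; rewrite !mxE.
split=> -[pX pmu]; split => //.
  by apply/rowP => k; rewrite momE pmu.
by move=> k; rewrite -momE pmu.
Qed.

Definition solve_head mu t X : 'rV[R]_q.+1 :=
  (mu - t *m tail_vdm X) *m invmx (head_vdm X).

(** Right multiplication by the invertible [head_vdm] passes between the linear system and its
    solved form. *)
Lemma solve_headP mu p : node_space R d (nodes p) ->
  prony_leaf d mu p <->
  colsub head (amplitudes p) =
    solve_head mu (colsub tail (amplitudes p)) (nodes p).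
Proof.
move=> pX; have uX := head_vdm_unit pX; rewrite prony_leafE /solve_head; split.
  by case=> _ <-; rewrite addrK mulmxK.
by move=> ->; split=> //; rewrite mulmxKV // subrK.
Qed.

(** The graph parametrization of the leaf. It is total, but its first amplitudes solve the Prony
    equations only where [head_vdm] is invertible, in particular over increasing nodes. *)
Definition leaf_point mu z : 'rV[R]_(d + d) :=
  row_mx (join_mx (solve_head mu (lsubmx z) (rsubmx z)) (lsubmx z)) (rsubmx z).

Lemma nodes_leaf_point mu z : nodes (leaf_point mu z) = rsubmx z.
Proof. by rewrite /nodes row_mxKr. Qed.

Lemma leaf_coordinatesE p :
  leaf_coordinates hq p = row_mx (colsub tail (amplitudes p)) (nodes p).
Proof.
by rewrite /leaf_coordinates; congr row_mx; apply/rowP => i; rewrite !mxE.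
Qed.

(** The coordinates forget the solved amplitudes, so this holds even when the nodes of [z] are not
    increasing. *)
Lemma leaf_pointK mu z : leaf_coordinates hq (leaf_point mu z) = z.
Proof.
rewrite leaf_coordinatesE nodes_leaf_point /amplitudes row_mxKl.
by rewrite colsub_tail_join hsubmxK.
Qed.

Lemma leaf_coordinatesK mu p :
  prony_leaf d mu p -> leaf_point mu (leaf_coordinates hq p) = p.
Proof.
move=> pmu; have [pX _] := pmu.
rewrite leaf_coordinatesE /leaf_point row_mxKl row_mxKr.
by rewrite -(solve_headP mu pX).1 // join_colsub hsubmxK.
Qed.

Lemma leaf_point_in mu z :
  node_space R d (rsubmx z) -> prony_leaf d mu (leaf_point mu z).
Proof.
move=> zX; apply/solve_headP; rewrite nodes_leaf_point //.
by rewrite /amplitudes row_mxKl colsub_head_join colsub_tail_join.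
Qed.

(** * Global coordinates on the leaf and the fibration over the nodes *)

Lemma regular_on_head_vdm (n : nat) (V : set 'rV[R]_n)
    (h : 'rV[R]_n -> 'rV[R]_d) :
  regular_map V h -> forall i j, regular_on V (fun x => head_vdm (h x) i j).
Proof.
move=> rh i j; apply: eq_regular_on (regular_onX j (rh (head i))) => x _.
by rewrite !mxE.
Qed.

Lemma regular_on_tail_vdm (n : nat) (V : set 'rV[R]_n)
    (h : 'rV[R]_n -> 'rV[R]_d) :
  regular_map V h -> forall i j, regular_on V (fun x => tail_vdm (h x) i j).
Proof.
move=> rh i j; apply: eq_regular_on (regular_onX j (rh (tail i))) => x _.
by rewrite !mxE.
Qed.

Lemma regular_leaf_point mu (V : set 'rV[R]_(d - q.+1 + d)) :
  (forall z, V z -> node_space R d (rsubmx z)) -> regular_map V (leaf_point mu).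
Proof.
move=> VX; apply: regular_map_row_mx; last exact: regular_map_rsubmx.
apply: head_tail_ind => i.
  apply: (@eq_regular_on _ _ _
      (fun z => solve_head mu (lsubmx z) (rsubmx z) 0 i)).
    by move=> z _; rewrite join_mx_head.
  apply: regular_on_mulmx => [k l|].
    apply: (@eq_regular_on _ _ _
      (fun z => mu 0 l - (lsubmx z *m tail_vdm (rsubmx z)) 0 l)).
      by move=> z _; rewrite ord1 [RHS]mxE; congr (_ + _); rewrite [RHS]mxE.
    apply: regular_onB; first exact: regular_on_cst.
    apply: regular_on_mulmx => [k' l'|].
      by rewrite ord1; exact: regular_map_lsubmx.
    by apply: regular_on_tail_vdm; exact: regular_map_rsubmx.
  apply: regular_on_invmx; first by move=> z /VX /head_vdm_unit.
  by apply: regular_on_head_vdm; exact: regular_map_rsubmx.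
apply: eq_regular_on (@regular_map_lsubmx R _ d V i) => z _.
by rewrite join_mx_tail.
Qed.

Lemma biregular_leaf_coordinates mu :
  biregular (prony_leaf d mu)
    (row_prod [set: 'rV[R]_(d - q.+1)] (node_space R d)) (leaf_coordinates hq).
Proof.
exists (leaf_point mu); split.
- apply: regular_map_row_mx; last exact: regular_map_rsubmx.
  move=> i; apply: eq_regular_on (regular_on_coord _ (lshift d (tail i))) => *.
  by rewrite !mxE.
- by apply: regular_leaf_point => z [].
- move=> p pmu; split; last exact: leaf_coordinatesK.
  by rewrite leaf_coordinatesE; split; rewrite ?row_mxKr //; case: pmu.
- by move=> z [_ zX]; split; [exact: leaf_point_in|exact: leaf_pointK].
Qed.

Lemma global_leaf_coordinates mu :
  global_coordinates (prony_leaf d mu)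
    (row_prod [set: 'rV[R]_(d - q.+1)] (node_space R d)) (leaf_coordinates hq).
Proof.
split; last exact: biregular_leaf_coordinates.
rewrite (_ : row_prod _ _ = [set z : 'rV[R]_(d - q.+1 + d) |
    forall i j : 'I_d, (i < j)%N ->
      z 0 (rshift (d - q.+1) i) < z 0 (rshift (d - q.+1) j)]).
  exact: open_increasing_coords.
apply/seteqP; split=> z /=.
  by move=> [_ zX] i j /zX; rewrite !mxE.
by move=> zX; split=> // i j /zX; rewrite !mxE.
Qed.

Lemma nodes_prony_leaf mu : @nodes R d @` prony_leaf d mu = node_space R d.
Proof.
apply/seteqP; split=> [_ [p [pX _] <-] //|X nX].
(* The preimage of X chosen here has all free amplitudes equal to zero. *)
exists (leaf_point mu (row_mx 0 X)); last by rewrite nodes_leaf_point row_mxKr.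
by apply: leaf_point_in; rewrite row_mxKr.
Qed.

Lemma nodes_fibration mu :
  regular_locally_trivial_fibration
    (prony_leaf d mu) (node_space R d) (@nodes R d).
Proof.
split; [exact: regular_map_rsubmx|by move=> p []|].
(* One trivialization works over the whole base, with the space of free amplitudes as fiber. *)
exists (d - q.+1)%N, setT => X _; exists setT.
exists ((fun z => row_mx (rsubmx z) (lsubmx z)) \o leaf_coordinates hq).
split=> //; first exact: openT.
  rewrite preimage_setT !setIT.
  exact: biregular_comp (biregular_leaf_coordinates mu)
    (biregular_row_prodC _ _).
by move=> p _ _ /=; rewrite row_mxKl leaf_coordinatesE row_mxKr.
Qed.

(** * Affine structure of the fibers *)

Definition fiber_direction X : 'M[R]_(d - q.+1, d + d) :=
  row_mx (join_mx (- (tail_vdm X *m invmx (head_vdm X))) 1%:M) 0.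

(** The solved amplitudes are affine in t, with linear part -t T(X) H(X)^-1. Row i of
    [fiber_direction] is thus the displacement of the leaf point when the i-th free amplitude grows
    by one; it does not depend on [mu]. *)
Lemma leaf_pointE mu t X :
  leaf_point mu (row_mx t X) =
  leaf_point mu (row_mx 0 X) + t *m fiber_direction X.
Proof.
rewrite /leaf_point !row_mxKl !row_mxKr mul_mx_row mulmx0 add_row_mx addr0.
rewrite mul_mx_join join_mxD mulmx1 add0r; congr (row_mx (join_mx _ _) _).
by rewrite /solve_head mul0mx subr0 mulmxBl mulmxN mulmxA.
Qed.

(** The identity block of [fiber_direction] gives back t as the tail amplitudes of the product. *)
Lemma fiber_direction_inj X : injective (fun t => t *m fiber_direction X).
Proof.
move=> t t' /(congr1 (fun p => colsub tail (lsubmx p))).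
by rewrite !mul_mx_row !row_mxKl !mul_mx_join !colsub_tail_join !mulmx1.
Qed.

Lemma affine_prony_fiber mu X : node_space R d X ->
  affine_subspace (prony_leaf d mu `&` [set p | nodes p = X]) (d - q - 1).
Proof.
move=> nX; exists (leaf_point mu (row_mx 0 X)).
pose f := linfun (@mulmxr R 1 _ _ (fiber_direction X)).
exists (limg f); split.
  (* The kernel of [f] is trivial, so the image has the dimension of the space of free
     amplitudes. *)
  rewrite limg_dim_eq; first by rewrite dimvf /dim /= mul1n subnS subn1.
  apply/eqP; rewrite capfv; apply/lker0P => t t'.
  by rewrite !lfunE; exact: fiber_direction_inj.
apply/seteqP; split=> p /=.
  move=> [pmu pX]; apply/memv_imgP; exists (colsub tail (amplitudes p)).
    exact: memvf.
  rewrite lfunE /= -[p in LHS](leaf_coordinatesK pmu) leaf_coordinatesE pX.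
  by rewrite leaf_pointE addrC addKr.
case/memv_imgP => t _; rewrite lfunE /= => /eqP; rewrite subr_eq addrC => /eqP.
rewrite -leaf_pointE => ->; split; last by rewrite nodes_leaf_point row_mxKr.
by apply: leaf_point_in; rewrite row_mxKr.
Qed.

(** * Smoothness by the Jacobian of the Prony equations *)

Definition prony_poly mu (k : 'I_q.+1) : mpoly (d + d) R :=
  \sum_(j < d) mpolyX R
    (mnm_add (mnm1 (lshift d j)) (mnm_muln (mnm1 (rshift d j)) k)) -
  mpolyC (d + d) (mu 0 k).

Lemma peval_prony_poly mu k p : peval (prony_poly mu k) p =
  \sum_(j < d) amplitudes p 0 j * nodes p 0 j ^+ k - mu 0 k.
Proof.
rewrite /peval rmorphB rmorph_sum /= mevalC; congr (_ - _).
apply: eq_bigr => j _.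
by rewrite mpolyXD -mpolyXn rmorphM rmorphXn /= !mevalXU !mxE.
Qed.

Lemma prony_leaf_locus mu :
  prony_leaf d mu = param_space R d `&` zero_locus (prony_poly mu).
Proof.
apply/seteqP; split=> p [pX pmu]; split=> // k.
  by rewrite peval_prony_poly pmu subrr.
by apply/eqP; rewrite -subr_eq0 -peval_prony_poly pmu.
Qed.

(* MathComp-Analysis has its own [jacobian]; the one of Defs is meant. *)
Lemma lsubmx_jacobian_prony mu p :
  lsubmx (Defs.jacobian (prony_poly mu) p) = Vandermonde q.+1 (nodes p).
Proof.
apply/matrixP => k i; rewrite !mxE /peval linearB linear_sum /= mderivC subr0.
(* Among the monomials a_j x_j^k only the one with j = i contains a_i, and its derivative in a_i is
   x_i^k. *)
rewrite rmorph_sum (bigD1 i) //= big1 ?addr0 => [|j ji].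
  rewrite mderivX mnmDE mulmnE !mnm1E eqxx eq_rlshift mul0n addn0 scale1r.
  by rewrite addmC addmK -mpolyXn rmorphXn /= mevalXU.
rewrite mderivX mnmDE mulmnE !mnm1E eq_rlshift mul0n addn0.
by rewrite (inj_eq (@lshift_inj _ _)) (negbTE ji) scale0r rmorph0.
Qed.

(** The columns of the first q + 1 amplitudes form the transpose of [head_vdm], an invertible square
    submatrix, so the rank reaches the number of rows. *)
Lemma rank_jacobian_prony mu p : node_space R d (nodes p) ->
  \rank (Defs.jacobian (prony_poly mu) p) = q.+1.
Proof.
move=> pX; apply/eqP; rewrite eqn_leq rank_leq_row /=.
have rkV : \rank (head_vdm (nodes p))^T = q.+1.
  by apply/eqP; rewrite [_ == _]row_free_unit unitmx_tr head_vdm_unit.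
rewrite -[X in (X <= _)%N]rkV.
(* Multiplying by columns of the identity matrix extracts these columns, and a product has rank at
   most that of its left factor. *)
have -> : (head_vdm (nodes p))^T =
    Defs.jacobian (prony_poly mu) p *m colsub (lshift d \o head) 1%:M.
  rewrite mulmx_colsub mulmx1 trmxK; apply/matrixP => k i.
  have /matrixP/(_ k (head i)) := lsubmx_jacobian_prony mu p.
  by rewrite !mxE => ->.
exact: mxrankM_maxl.
Qed.

Lemma smooth_prony_leaf mu :
  smooth_subvariety (param_space R d) (prony_leaf d mu) (2 * d - q - 1).
Proof.
split; first by exists q.+1, (prony_poly mu); exact: prony_leaf_locus.
(* The same global equations serve at every point, with the whole space as neighbourhood. *)
move=> p [pX _]; exists q.+1, (prony_poly mu), setT; split.
- by rewrite -subnDA addn1 subnKC mul2n -addnn // ltn_addr.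
- by rewrite prony_leaf_locus => p' [].
- by split=> //; exact: openT.
- by rewrite !setIT prony_leaf_locus.
- exact: rank_jacobian_prony.
Qed.

End PronyLeaf.

Theorem theorem4p1 (R : realType) (d q : nat) (hd : (1 <= d)%N)
    (hq : (q < d)%N) :
  exists (A : 'I_d -> 'I_q.+1 -> 'rV[R]_d -> R)
         (B : 'I_d -> 'I_d -> 'rV[R]_d -> R),
    [/\ forall (j : 'I_d) (l : 'I_q.+1), (j <= q)%N ->
          regular_on (node_space R d) (A j l),
        forall j s : 'I_d, (j <= q)%N -> (q < s)%N ->
          regular_on (node_space R d) (B j s) &
        forall mu : 'rV[R]_q.+1,
          [/\ smooth_subvariety (param_space R d) (prony_leaf d mu)
                (2 * d - q - 1),
              [/\ @nodes R d @` prony_leaf d mu = node_space R d,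
                  regular_locally_trivial_fibration
                    (prony_leaf d mu) (node_space R d) (@nodes R d) &
                  forall X, node_space R d X ->
                    affine_subspace
                      (prony_leaf d mu `&` [set p | nodes p = X]) (d - q - 1)],
              global_coordinates (prony_leaf d mu)
                (row_prod [set: 'rV[R]_(d - q.+1)] (node_space R d))
                (leaf_coordinates hq) &
              forall p, prony_leaf d mu p -> forall j : 'I_d, (j <= q)%N ->
                amplitudes p 0 j =
                  \sum_(l < q.+1) A j l (nodes p) * mu 0 l +
                  \sum_(s < d | (q < s)%N) B j s (nodes p) * amplitudes p 0 s]].
Proof.
(* In row-vector form mu H^-1 has j-th entry the sum of mu_l (H^-1)_(l,j), hence the transposed
   indices. For j <= q, [inord] keeps the value of j; beyond q it defaults to 0. *)
pose A (j : 'I_d) (l : 'I_q.+1) (X : 'rV[R]_d) :=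
  invmx (head_vdm hq X) l (inord j).
have regA j l : regular_on (node_space R d) (A j l).
  apply: regular_on_invmx => [X|]; first exact: head_vdm_unit.
  by apply: regular_on_head_vdm => i; exact: regular_on_coord.
(* B_(j,s) is the entry (s,j) of -T H^-1, where the row of T belonging to s consists of the powers
   of x_s. *)
exists A, (fun j s (X : 'rV[R]_d) => - \sum_(l < q.+1) X 0 s ^+ l * A j l X); split.
- by move=> j l _; exact: regA.
- move=> j s _ _; apply: regular_onN; apply: regular_on_sum => l _.
  by apply: regular_onM => //; apply: regular_onX; exact: regular_on_coord.
move=> mu; split; first exact: smooth_prony_leaf.
- split; [exact: nodes_prony_leaf|exact: nodes_fibration|].
  by move=> X; exact: affine_prony_fiber.
- exact: global_leaf_coordinates.
(* A tail index has value q + 1 + i, which contradicts the bound j <= q. *)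
move=> p pmu; apply: (@head_tail_ind d q hq) => i jq; last first.
  by rewrite leqNgt /= ltnS leq_addr in jq.
have pX : node_space R d (nodes p) by case: pmu.
have /rowP/(_ i) := (solve_headP hq mu pX).1 pmu.
rewrite [LHS]mxE /solve_head mulmxBl => ->; rewrite [LHS]mxE [X in _ + X]mxE.
have Ai l : A (head_index hq i) l (nodes p) = invmx (head_vdm hq (nodes p)) l i.
  by rewrite /A /= inord_val.
congr (_ + _).
  by rewrite mxE; apply: eq_bigr => l _; rewrite Ai mulrC.
(* Reassociating t T H^-1 as t (T H^-1) exposes the coefficient of each free amplitude. *)
rewrite big_tail -mulmxA mxE -sumrN; apply: eq_bigr => s _.
rewrite mulNr mxE mulrC [in LHS]mxE; congr (- (_ * _)).
by apply: eq_bigr => l _; rewrite Ai !mxE.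
Qed.
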